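(* Let $R$ be a left perfect ring. Then $R\text{-conat}=\{\mathbb{T}_\sigma\mid\sigma \text{ is a } t\text{-radical on } R\text{-Mod}\}$.
   Context: $R$ is an associative ring with identity; modules are left $R$-modules. A preradical on $R\text{-Mod}$ is a functor $\sigma:R\text{-Mod}\to R\text{-Mod}$ with $\sigma(M)\le M$ for all $M$ and $f(\sigma(M))\le\sigma(N)$ for every homomorphism $f:M\to N$ ($\sigma(f)$ being the restriction of $f$). $\sigma$ is a $t$-radical if $\sigma(M)=\sigma(R)M$ for every module $M$. $\mathbb{T}_\sigma=\{M\mid\sigma(M)=M\}$. For a class $\mathscr{D}$ of modules closed under quotients, $\mathscr{D}^{\perp_\twoheadrightarrow}$ is the class of all modules having no nonzero quotient in $\mathscr{D}$. $R\text{-conat}$ is the collection of conatural classes, i.e. classes of the form $\mathscr{D}^{\perp_\twoheadrightarrow}$ with $\mathscr{D}$ a class of modules closed under quotients. $R$ is left perfect if every left $R$-module has a projective cover. *)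

(* Defs.v *)
From HB Require Import structures.
From mathcomp Require Import all_boot all_order all_algebra.

Set Implicit Arguments.
Unset Strict Implicit.
Unset Printing Implicit Defensive.

Import GRing.Theory.
Local Open Scope ring_scope.

(* A class of modules is a predicate on [lmodType R]; quotients of [M] are
   taken up to isomorphism, i.e. as targets of surjective linear maps from [M]. *)
Definition module_class (R : pzRingType) := lmodType R -> Prop.

Definition surjective (A B : Type) (f : A -> B) : Prop :=
  forall y, exists x, f x = y.

Definition zero_module (R : pzRingType) (M : lmodType R) : Prop :=
  forall x : M, x = 0.

Definition quotient_closed (R : pzRingType) (D : module_class R) : Prop :=
  forall (M N : lmodType R) (f : {linear M -> N}),
    surjective f -> D M -> D N.

Definition quot_perp (R : pzRingType) (D : module_class R) : module_class R :=
  fun M => forall (N : lmodType R) (f : {linear M -> N}),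
    surjective f -> D N -> zero_module N.

Definition conatural (R : pzRingType) (C : module_class R) : Prop :=
  exists D : module_class R,
    quotient_closed D /\ (forall M, C M <-> quot_perp D M).

(* The action on morphisms is restriction, so functoriality is automatic once
   every [f] maps sigma(M) into sigma(N). *)
Record preradical (R : pzRingType) := Preradical {
  prerad :> forall M : lmodType R, submodClosed M;
  prerad_hom : forall (M N : lmodType R) (f : {linear M -> N}) (x : M),
    x \in prerad M -> f x \in prerad N
}.

(* Membership in I M, the set of finite sums of products a m, a in I. *)
Definition in_ideal_mul (R : pzRingType) (I : {pred R}) (M : lmodType R)
    (x : M) : Prop :=
  exists2 s : seq (R * M),
    all (fun p => p.1 \in I) s & x = \sum_(p <- s) p.1 *: p.2.

(* [R^o] is R as a left module over itself. *)
Definition t_radical (R : pzRingType) (sigma : preradical R) : Prop :=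
  forall (M : lmodType R) (x : M),
    x \in sigma M <-> in_ideal_mul (R := R) (sigma R^o) x.

Definition torsion_class (R : pzRingType) (sigma : preradical R) :
    module_class R :=
  fun M => forall x : M, x \in sigma M.

Definition projective (R : pzRingType) (P : lmodType R) : Prop :=
  forall (M N : lmodType R) (g : {linear M -> N}) (f : {linear P -> N}),
    surjective g -> exists h : {linear P -> M}, forall x, g (h x) = f x.

(* Submodules are boolean predicates; under the classical axioms of Rocq these
   are all submodules. K is superfluous when K + L = M implies L = M. *)
Definition superfluous (R : pzRingType) (M : lmodType R) (K : {pred M}) :
    Prop :=
  forall L : submodClosed M,
    (forall x : M, exists k l, [/\ k \in K, l \in L & x = k + l]) ->
    forall x : M, x \in L.

Definition projective_cover (R : pzRingType) (P M : lmodType R)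
    (p : {linear P -> M}) : Prop :=
  [/\ projective P, surjective p & superfluous [pred x | p x == 0]].

Definition left_perfect (R : pzRingType) : Prop :=
  forall M : lmodType R,
    exists (P : lmodType R) (p : {linear P -> M}), projective_cover p.

(* Main.v *)
Require Import Defs.
From HB Require Import structures.
From mathcomp Require Import all_boot all_order all_algebra.
From mathcomp Require Import boolp classical_sets functions.

(** Every t-radical is M |-> IM for a two-sided ideal I, and I = sigma(R); its
    torsion class is { M | IM = M }.

    Over any ring such a class is conatural: take for D the modules killed by
    I. If IM = M then a quotient of M killed by I is zero, and conversely the
    largest quotient of M killed by I is M/IM [torsion_class_conatural].

    Conversely let C consist of the modules without nonzero quotient in D, and
    let I be the common annihilator of the class E of simple modules in D; it
    is a two-sided ideal. Two consequences of perfectness give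
    C = { M | IM = M }.

    - If M has no quotient in E then IM = M [in_ideal_mul_cover]. Let P -> M be
      a projective cover. Its kernel is superfluous, so it is contained in
      every maximal submodule of P, and every map from P onto a simple module
      factors through M [cover_simple_quotient]. Thus every map from P to a
      module S in E is zero. For f : P -> R and s in S the map x |-> f(x) s is
      then zero, whence f(P) is contained in I; the dual basis property
      [dual_basis] writes x in P as a sum of terms f_p(x) p, so P = IP, and
      M = IM follows.

    - A nonzero module N has a simple quotient [nonzero_simple_quotient].
      Otherwise, by the same argument with E all simple modules, the
      functionals of a projective cover P of N take values in the Jacobson
      radical J. Applying f_k to x = sum_j f_j(x) p_j gives
      f_k(x) = sum_j f_j(x) f_k(p_j), a finite linear system with coefficients
      in J; since 1 - a is invertible for a in J it has only the zero solution
      [jacobson_elimination]. So P = 0 and N = 0.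

    If now IM = M and N in D is a nonzero quotient of M, then N has a simple
    quotient S, which is in E because D is closed under quotients; but
    S = IS = 0. *)

Set Implicit Arguments.
Unset Strict Implicit.
Unset Printing Implicit Defensive.

Import GRing.Theory.
Local Open Scope ring_scope.

(** * Linear maps, submodules and quotients as modules *)

Lemma linear_fun_exists (R : pzRingType) (M N : lmodType R) (g : M -> N) :
  linear g -> exists h : {linear M -> N}, forall x, h x = g x.
Proof.
move=> lin_g; pose mixin := GRing.isLinear.Build R M N *:%R g lin_g.
by exists (HB.pack_for {linear M -> N} g mixin).
Qed.

Section SubmoduleOfPredicate.
Variables (R : pzRingType) (V : lmodType R) (A : V -> Prop).
Hypotheses (A0 : A 0) (A_lin : forall a x y, A x -> A y -> A (a *: x + y)).

Let mem_A : {pred V} := fun x => `[< A x >].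

Fact mem_A_closed : submod_closed mem_A.
Proof.
split=> [|a x y /asboolP Ax /asboolP Ay]; first exact/asboolP.
by apply/asboolP; apply: A_lin.
Qed.

Definition submod_of_Prop : submodClosed V :=
  HB.pack_for (submodClosed V) mem_A
    (GRing.isSubmodClosed.Build R V mem_A mem_A_closed).

Lemma submod_of_PropP x : reflect (A x) (x \in submod_of_Prop).
Proof. exact: asboolP. Qed.

End SubmoduleOfPredicate.

Section Submodule.
Variables (R : pzRingType) (V : lmodType R) (K : submodClosed V).

Definition submodule := {x : V | x \in K}.

HB.instance Definition _ := SubChoice.on submodule.
HB.instance Definition _ :=
  [SubChoice_isSubLmodule of submodule by <:].

Lemma submodule_exists :
  exists (F : lmodType R) (i : {linear F -> V}),
    (forall u, i u \in K) /\ (forall x, x \in K -> exists u, i u = x).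
Proof.
have [|i iE] := @linear_fun_exists R submodule V val; first by [].
exists submodule, i; split=> [u|x Kx]; first by rewrite iE (valP u).
by exists (Sub x Kx); rewrite iE SubK.
Qed.

End Submodule.

Section Quotient.
Variables (R : pzRingType) (V : lmodType R) (K : submodClosed V).

Fact submod_zmod_closed : zmod_closed K.
Proof.
by split=> [|x y Kx Ky]; rewrite ?rpred0 // -scaleN1r rpredD // rpredZ.
Qed.

Let KZ : zmodClosed V :=
  HB.pack_for (zmodClosed V) (GRing.SubmodClosed.sort K)
    (GRing.isZmodClosed.Build V (GRing.SubmodClosed.sort K) submod_zmod_closed).

Definition quotient_module := Quotient.quot KZ.
HB.instance Definition _ := GRing.Zmodule.on quotient_module.

Let proj (x : V) : quotient_module := \pi_(Quotient.quot KZ)%qT x.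

Let projE x y : proj x = proj y <-> x - y \in K.
Proof.
rewrite -[_ \in K]/(x - y \in KZ) Quotient.idealrBE.
by split => [/eqP | /eqP].
Qed.

Let projB : {morph proj : x y / x - y >-> x - y}.
Proof. by move=> x y; rewrite /proj raddfB. Qed.

Let projD : {morph proj : x y / x + y >-> x + y}.
Proof. by move=> x y; rewrite /proj raddfD. Qed.

Let rep (u : quotient_module) : V := repr (u : Quotient.quot KZ).

Let repK : cancel rep proj.
Proof. by move=> u; rewrite /proj /rep reprK. Qed.

Let qscale (a : R) (u : quotient_module) : quotient_module :=
  proj (a *: rep u).

Let qscaleE a x : qscale a (proj x) = proj (a *: x).
Proof.
apply/projE; rewrite -scalerBr rpredZ //.
by apply/projE; rewrite repK.
Qed.

Fact qscaleA a b v : qscale a (qscale b v) = qscale (a * b) v.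
Proof. by rewrite -[v]repK !qscaleE scalerA. Qed.
Fact qscale1 : left_id 1 qscale.
Proof. by move=> v; rewrite -[v]repK !qscaleE scale1r. Qed.
Fact qscaleDr : right_distributive qscale +%R.
Proof.
by move=> a u v; rewrite -[u]repK -[v]repK -projD !qscaleE scalerDr projD.
Qed.
Fact qscaleDl v : {morph qscale^~ v : a b / a + b}.
Proof. by move=> a b; rewrite -[v]repK !qscaleE scalerDl projD. Qed.

HB.instance Definition _ :=
  GRing.Zmodule_isLmodule.Build R quotient_module
    qscaleA qscale1 qscaleDr qscaleDl.

Lemma quotient_exists :
  exists (Q : lmodType R) (q : {linear V -> Q}),
    surjective q /\ (forall x, q x = 0 <-> x \in K).
Proof.
have [|q qE] := @linear_fun_exists R V quotient_module proj.
  by move=> a x y; rewrite projD -qscaleE.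
exists quotient_module, q; split=> [u|x].
  by exists (rep u); rewrite qE repK.
have <- : proj 0 = 0 by rewrite -(subrr 0) projB subrr.
by rewrite qE projE subr0.
Qed.

End Quotient.

(** * Simple modules and their annihilators *)

Section SimpleModules.
Variable R : pzRingType.

(** A nonzero module generated by each of its nonzero elements: equivalent to
    having exactly two submodules, without quantifying over submodules. *)
Definition simple (S : lmodType R) : Prop :=
  (exists x : S, x <> 0) /\
  (forall x y : S, x <> 0 -> exists a, y = a *: x).

Lemma simple_surjective (M S : lmodType R) (f : {linear M -> S}) (x : M) :
  simple S -> f x <> 0 -> surjective f.
Proof.
case=> _ simS fx0 y; have [a ->] := simS _ y fx0.
by exists (a *: x); rewrite linearZ.
Qed.

(** If the superfluous kernel of p were not contained in ker q, it would map
    onto S, since S is simple; then ker p + ker q = P, and superfluity would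
    force ker q = P. Hence q factors through p. *)
Lemma cover_simple_quotient (P N S : lmodType R) (p : {linear P -> N})
    (q : {linear P -> S}) (x : P) :
    projective_cover p -> simple S -> q x <> 0 ->
  exists g : {linear N -> S}, surjective g.
Proof.
move=> [_ surj_p sup_p] simS qx0.
have q_ker k : p k = 0 -> q k = 0.
  move=> pk0; apply: contrapT => qk0; apply: qx0.
  have ker0 : q 0 = 0 by rewrite linear0.
  have ker_lin a y z : q y = 0 -> q z = 0 -> q (a *: y + z) = 0.
    by move=> qy qz; rewrite linearP qy qz scaler0 addr0.
  (* ker q is everything because ker p + ker q is: q y is a multiple of q k. *)
  apply/(submod_of_PropP ker0 ker_lin); apply: sup_p => y.
  have [a qyE] := simS.2 _ (q y) qk0.
  exists (a *: k), (y - a *: k); split; last by rewrite addrC subrK.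
    by rewrite inE linearZ /= pk0 scaler0.
  by apply/submod_of_PropP; rewrite linearB linearZ /= qyE subrr.
have [sec secK] := choice surj_p.
have gp u : q (sec (p u)) = q u.
  by apply/eqP; rewrite -subr_eq0 -linearB q_ker // linearB /= secK subrr.
have [|g gE] := @linear_fun_exists R N S (q \o sec).
  move=> a y z /=; rewrite -[y]secK -[z]secK -linearP !gp.
  by rewrite linearP.
exists g; apply: (@simple_surjective _ _ g (p x)) => //.
by rewrite gE /= gp.
Qed.

(** For E the class of all simple modules this is membership in the Jacobson
    radical. *)
Definition annihilates (E : module_class R) (a : R) : Prop :=
  forall S, E S -> forall s : S, a *: s = 0.

Lemma annihilates0 E : annihilates E 0.
Proof. by move=> S _ s; rewrite scale0r. Qed.

Lemma annihilatesD E a b :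
  annihilates E a -> annihilates E b -> annihilates E (a + b).
Proof. by move=> Ea Eb S ES s; rewrite scalerDl Ea // Eb // addr0. Qed.

Lemma annihilates_mull E a b : annihilates E b -> annihilates E (a * b).
Proof. by move=> Eb S ES s; rewrite -scalerA Eb // scaler0. Qed.

Lemma annihilates_mulr E a b : annihilates E a -> annihilates E (a * b).
Proof. by move=> Ea S ES s; rewrite -scalerA Ea. Qed.

(** For s in S, x |-> f(x) s is a linear map from P to S, so it is zero. *)
Lemma functional_annihilates (E : module_class R) (P : lmodType R) :
    (forall S, E S -> forall (q : {linear P -> S}) x, q x = 0) ->
  forall (f : {linear P -> R^o}) x, annihilates E (f x).
Proof.
move=> noE f x S ES s.
have [|q qE] := @linear_fun_exists R P S (fun y => (f y : R) *: s).
  by move=> a y z; rewrite linearP scalerDl scalerA.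
by rewrite -qE noE.
Qed.

Section MaximalLeftIdeal.
Variable L : R -> Prop.

Definition left_ideal (X : R -> Prop) :=
  X 0 /\ forall a x y, X x -> X y -> X (a * x + y).

(** The last clause is maximality: adjoining an element outside X yields the
    whole ring. *)
Lemma maximal_left_ideal : left_ideal L -> ~ L 1 ->
  exists X : R -> Prop,
    [/\ left_ideal X, forall x, L x -> X x, ~ X 1
      & forall x, ~ X x -> exists a y, X y /\ 1 = a * x + y].
Proof.
move=> [L0 L_lin] L1.
(* Zorn's lemma includes the empty chain, whose union is not a left ideal;
   hence the condition bears on the union of X with L. *)
pose proper (X : set R) :=
  left_ideal (X `|` L)%classic /\ ~ (X `|` L)%classic 1.
have [F Fproper Ftot|A [[A_id A1] Amax]] := @Zorn_bigcup R proper.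
  split; last first.
    case=> [[X FX X1]|//]; have [_] := Fproper _ FX; apply; by left.
  split=> [|a x y]; first by right.
  have lin X : F X -> (X `|` L)%classic x -> (X `|` L)%classic y ->
      (\bigcup_(X in F) X `|` L)%classic (a * x + y).
    move=> FX Xx Xy; have [[_ /(_ a _ _ Xx Xy) [Xaxy|Laxy]] _] := Fproper _ FX.
      by left; exists X.
    by right.
  move=> [[X FX Xx]|Lx] [[Y FY Yy]|Ly].
  - have [XY|YX] := Ftot _ _ FX FY.
      by apply: (lin Y) => //; left => //; apply: XY.
    by apply: (lin X) => //; left => //; apply: YX.
  - by apply: (lin X) => //; [left|right].
  - by apply: (lin Y) => //; [right|left].
  - by right; apply: L_lin.
exists (A `|` L)%classic; split=> // [x Lx|x nAx]; first by right.
(* Maximality is tested against B = (A u L) + Rx, which already contains L. *)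
pose B : set R :=
  [set z | exists a y, (A `|` L)%classic y /\ z = a * x + y]%classic.
have AB y : (A `|` L)%classic y -> B y by exists 0, y; rewrite mul0r add0r.
have Bx : B x by exists 1, 0; split; [case: A_id|rewrite mul1r addr0].
apply: contrapT => nB1; apply: (Amax B).
  split=> [y Ay|BA]; first by apply: AB; left.
  by apply: nAx; left; apply: BA.
have BL : (B `|` L)%classic = B.
  by apply/seteqP; split=> [y [//|Ly]|y]; [apply: AB; right|left].
rewrite /proper BL; split=> //.
split=> [|a _ _ [b [y [Ay ->]]] [c [z [Az ->]]]].
  by apply: AB; case: A_id.
exists (a * b + c), (a * y + z); split; first by case: A_id => _; apply.
by rewrite mulrDr mulrDl mulrA addrACA.
Qed.

End MaximalLeftIdeal.

(** S is the quotient of R by a maximal left ideal containing L. *)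
Lemma simple_quotient_regular (L : R -> Prop) : left_ideal L -> ~ L 1 ->
  exists (S : lmodType R) (q : {linear R^o -> S}),
    [/\ simple S, q 1 <> 0 & forall x, L x -> q x = 0].
Proof.
move=> Lid /(maximal_left_ideal Lid) [X [[X0 X_lin] LX X1 Xmax]].
have [S [q [surj_q q0]]] :=
  quotient_exists (@submod_of_Prop R R^o X X0 X_lin).
have qX x : q x = 0 <-> X x.
  by rewrite q0; split=> [/submod_of_PropP|?] //; apply/submod_of_PropP.
have q1 : q 1 <> 0 by move/qX.
exists S, q; split=> // [|x /LX /qX //]; split; first by exists (q 1).
move=> u v u0; have [x qx] := surj_q u; have [y qy] := surj_q v.
have [a [z [Xz oneE]]] : exists a z, X z /\ 1 = a * x + z.
  by apply: Xmax => /qX; rewrite qx.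
have yE : y = (y * a) *: x + y *: (z : R^o).
  by rewrite -[LHS]mulr1 oneE mulrDr mulrA.
exists (y * a); rewrite -qx -qy {1}yE linearD !linearZ /= ((qX z).2 Xz) scaler0.
exact: addr0.
Qed.

(** A left inverse u of 1 - a exists because a proper left ideal containing
    1 - a would give a simple module with a nonzero element fixed by a, whereas
    a annihilates all simple modules. As u = 1 + u a is again of
    this form, it has a left inverse too, so u is a two-sided inverse. The right
    inverse is the one that elimination uses. *)
Lemma jacobson_quasiregular a : annihilates simple a ->
  exists u, (1 - a) * u = 1.
Proof.
have left_inv b : annihilates simple b -> exists u, u * (1 - b) = 1.
  move=> Jb; apply: contrapT => no_inv.
  pose L x := exists u, u * (1 - b) = x.
  have L_id : left_ideal L.
    split=> [|c _ _ [u <-] [v <-]]; first by exists 0; rewrite mul0r.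
    by exists (c * u + v); rewrite mulrDl mulrA.
  have [S [q [simS q1 qL]]] := simple_quotient_regular L_id no_inv.
  apply: q1; have : q (1 - b) = 0 by apply: qL; exists 1; rewrite mul1r.
  rewrite linearB => /eqP; rewrite subr_eq0 => /eqP ->.
  by rewrite -[b]mulr1 -[b * 1]/(b *: (1 : R^o)) linearZ /= Jb.
move=> Ja; have [u ua] := left_inv a Ja.
have uE : u = 1 - (- u * a) by rewrite mulNr opprK -ua mulrBr mulr1 subrK.
have [v vu] : exists v, v * u = 1.
  by rewrite uE; apply: left_inv; apply: annihilates_mull.
exists u; suff <- : v = 1 - a by [].
by have := mulrA v u (1 - a); rewrite ua vu mulr1 mul1r.
Qed.

(** Solve the equation of the first unknown for r_n, which is possible since
    1 - a_nn is invertible, and substitute: the coefficients of the smaller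
    system are still in the radical because it is an ideal. The system has an
    equation for every k in T although only the r_j with j in s occur on the
    right, so that no membership has to be tracked. *)
Lemma jacobson_elimination (T : Type) (s : seq T) (r : T -> R)
    (a : T -> T -> R) :
    (forall j k, annihilates simple (a j k)) ->
    (forall k, r k = \sum_(j <- s) r j * a j k) ->
  forall k, r k = 0.
Proof.
elim: s a => [|n s IHs] a Ja rE k; first by rewrite rE big_nil.
have [u ua] := jacobson_quasiregular (Ja n n).
have rn : r n = \sum_(j <- s) r j * (a j n * u).
  under eq_bigr do rewrite mulrA.
  rewrite -mulr_suml -[LHS]mulr1 -ua mulrA mulrBr mulr1 {1}rE big_cons.
  by rewrite addrC addKr.
apply: (IHs (fun j k => a j n * u * a n k + a j k)) => [i j|i].
  by apply: annihilatesD => //; apply: annihilates_mull.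
rewrite rE big_cons rn mulr_suml -big_split /=.
by apply: eq_bigr => j _; rewrite mulrDr !mulrA.
Qed.

End SimpleModules.

(** * Dual bases of projective modules *)

Section DualBasis.
Variables (R : pzRingType) (P : lmodType R).

(** The pairs (phi, x) such that the sum of phi(p) p takes the value x on all
    large enough finite subsets of P. They form a submodule of (P -> R) * P that
    contains (delta_p, p) for every p, so its second projection onto P replaces
    the free module on P: a section of that projection provides the coordinates
    of x. Asking for all large enough subsets makes closure under addition
    immediate. *)
Definition sums_to (c : (P -> R^o) * P) : Prop :=
  exists s : seq P, forall t, uniq t -> {subset s <= t} ->
    c.2 = \sum_(p <- t) (c.1 p : R) *: p.

Fact sums_to0 : sums_to 0.
Proof. by exists [::] => t _ _; rewrite big1 // => p _; rewrite scale0r. Qed.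

Fact sums_to_lin a c d : sums_to c -> sums_to d -> sums_to (a *: c + d).
Proof.
move=> [s cs] [s' ds]; exists (s ++ s') => t t_uniq sub.
rewrite /= (cs t) // => [|p ps]; last by rewrite sub // mem_cat ps.
rewrite (ds t) // => [|p ps]; last by rewrite sub // mem_cat ps orbT.
rewrite scaler_sumr -big_split /=; apply: eq_bigr => p _.
by rewrite scalerA -scalerDl.
Qed.

Lemma dual_basis : projective P ->
  exists f : P -> {linear P -> R^o},
    forall x, exists s : seq P, x = \sum_(p <- s) (f p x : R) *: p.
Proof.
move=> projP.
have [F [i [i_sums i_surj]]] :=
  submodule_exists (submod_of_Prop sums_to0 sums_to_lin).
have [|g gE] := @linear_fun_exists R F P (fun u => (i u).2).
  by move=> a u v; rewrite linearP.
have [|h hK] := projP F P g idfun.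
  move=> x; pose delta : P -> R^o := fun p => (p == x)%:R.
  have /i_surj [u uE] : (delta, x) \in submod_of_Prop sums_to0 sums_to_lin.
    apply/submod_of_PropP; exists [:: x] => t t_uniq sub /=.
    rewrite (bigD1_seq x) ?sub ?mem_head //= /delta eqxx scale1r big1 ?addr0 //.
    by move=> p /negPf ->; rewrite scale0r.
  by exists u; rewrite gE uE.
have coord p : exists f : {linear P -> R^o}, forall x, f x = (i (h x)).1 p.
  by apply: linear_fun_exists => a x y; rewrite !linearP.
have [f fE] := choice coord.
exists f => x; have /submod_of_PropP [s sE] := i_sums (h x).
exists (undup s); rewrite -[LHS]hK gE (sE (undup s)) ?undup_uniq //.
  by apply: eq_bigr => p _; rewrite fE.
by move=> p; rewrite mem_undup.
Qed.

End DualBasis.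

(** * Consequences of the existence of projective covers *)

Section Perfect.
Variable R : pzRingType.

(** Bass: a projective cover P of N has a simple quotient if it is nonzero, and
    that quotient is one of N. *)
Lemma nonzero_simple_quotient (N : lmodType R) :
    left_perfect R -> ~ zero_module N ->
  exists (S : lmodType R) (g : {linear N -> S}), simple S /\ surjective g.
Proof.
move=> /(_ N) [P [p p_cover]] N0; apply: contrapT => noS; apply: N0.
have [projP surj_p _] := p_cover.
have noP S : simple S -> forall (q : {linear P -> S}) x, q x = 0.
  move=> simS q x; apply: contrapT => qx.
  have [g surj_g] := cover_simple_quotient p_cover simS qx.
  by apply: noS; exists S, g.
have [f f_basis] := dual_basis projP.
move=> y; have [x <-] := surj_p y; have [s xE] := f_basis x.
suff fx0 k : f k x = 0.
  by rewrite xE big1 ?linear0 // => k _; rewrite fx0 scale0r.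
(* The unknowns are the coordinates of x; the coefficients are the coordinates
   of the elements in s. *)
apply: (@jacobson_elimination R P s (fun k => f k x) (fun j k => f k j)).
  by move=> i j; apply: functional_annihilates noP _ _.
move=> i; rewrite [in LHS]xE linear_sum; apply: eq_bigr => j _.
by rewrite linearZ.
Qed.

(** A projective cover P of M has no map onto a module of E either, so its
    functionals take values in the annihilator of E, and the dual basis property
    exhibits the elements of P, hence those of M, as the required sums. *)
Lemma in_ideal_mul_cover (E : module_class R) (M : lmodType R) :
    left_perfect R -> (forall S, E S -> simple S) ->
    (forall S, E S -> forall g : {linear M -> S}, ~ surjective g) ->
  forall x : M, in_ideal_mul (fun a => `[< annihilates E a >]) x.
Proof.
move=> /(_ M) [P [p p_cover]] simE noM.
have [projP surj_p _] := p_cover.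
have noP S : E S -> forall (q : {linear P -> S}) x, q x = 0.
  move=> ES q x; apply: contrapT => qx.
  have [g surj_g] := cover_simple_quotient p_cover (simE S ES) qx.
  exact: noM ES g surj_g.
have [f f_basis] := dual_basis projP.
move=> y; have [x <-] := surj_p y; have [s xE] := f_basis x.
exists [seq (f k x : R, p k) | k <- s].
  apply/allP => _ /mapP [k _ ->]; apply/asboolP.
  exact: functional_annihilates noP _ _.
by rewrite [in LHS]xE linear_sum big_map; apply: eq_bigr => k _; exact: linearZ.
Qed.

End Perfect.

(** * t-radicals and two-sided ideals *)

Section IdealRadical.
Variables (R : pzRingType) (I : {pred R}).
Hypotheses (I0 : 0 \in I) (ID : {in I &, forall a b, a + b \in I}).
Hypotheses (IMl : forall a, {in I, forall b, a * b \in I}).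
Hypotheses (IMr : forall b, {in I, forall a, a * b \in I}).

Fact in_ideal_mul0 (M : lmodType R) : in_ideal_mul I (0 : M).
Proof. by exists [::]; rewrite ?big_nil. Qed.

Fact in_ideal_mul_lin (M : lmodType R) a (x y : M) :
  in_ideal_mul I x -> in_ideal_mul I y -> in_ideal_mul I (a *: x + y).
Proof.
move=> [s Is ->] [t It ->]; exists ([seq (a * p.1, p.2) | p <- s] ++ t).
  rewrite all_cat It andbT; apply/allP => _ /mapP [p sp ->] /=.
  by apply: IMl; apply: (allP Is).
rewrite big_cat big_map scaler_sumr; congr (_ + _).
by apply: eq_bigr => p _; rewrite scalerA.
Qed.

Fact in_ideal_mul_hom (M N : lmodType R) (f : {linear M -> N}) (x : M) :
  in_ideal_mul I x -> in_ideal_mul I (f x).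
Proof.
move=> [s Is ->]; exists [seq (p.1, f p.2) | p <- s].
  by apply/allP => _ /mapP [p sp ->]; apply: (allP Is).
by rewrite linear_sum big_map; apply: eq_bigr => p _; rewrite linearZ.
Qed.

Definition ideal_mul (M : lmodType R) : submodClosed M :=
  submod_of_Prop (in_ideal_mul0 M) (@in_ideal_mul_lin M).

Fact ideal_mul_hom (M N : lmodType R) (f : {linear M -> N}) (x : M) :
  x \in ideal_mul M -> f x \in ideal_mul N.
Proof.
by move=> /submod_of_PropP Ix; apply/submod_of_PropP; apply: in_ideal_mul_hom.
Qed.

Definition ideal_radical : preradical R := Preradical ideal_mul_hom.

Lemma ideal_radicalP (M : lmodType R) (x : M) :
  reflect (in_ideal_mul I x) (x \in ideal_radical M).
Proof. exact: submod_of_PropP. Qed.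

(** Here I must be a right ideal, as IR is the right ideal generated by I. *)
Lemma ideal_radical_regular (a : R^o) : (a \in ideal_radical R^o) = (a \in I).
Proof.
apply/ideal_radicalP/idP => [[s Is ->]|Ia].
  rewrite big_seq; elim/big_ind: _ => [//|b c|p sp]; first exact: ID.
  by apply: IMr; apply: (allP Is).
by exists [:: (a, 1)]; [rewrite /= Ia | rewrite big_seq1; exact/esym/mulr1].
Qed.

Lemma ideal_radical_t : t_radical ideal_radical.
Proof.
move=> M x; split=> [/ideal_radicalP|] [s Is ->].
  exists s => //; apply/allP => p sp; rewrite ideal_radical_regular.
  exact: (allP Is).
apply/ideal_radicalP; exists s => //; apply/allP => p sp.
by rewrite -ideal_radical_regular (allP Is).
Qed.

End IdealRadical.

(** The class D of modules killed by sigma(R) works: M/sigma(M) is in D, and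
    every quotient of M in D is a quotient of M/sigma(M). *)
Lemma torsion_class_conatural (R : pzRingType) (sigma : preradical R) :
  t_radical sigma -> conatural (torsion_class sigma).
Proof.
move=> t_sigma.
pose D : module_class R := fun N =>
  forall (a : R), a \in sigma R^o -> forall n : N, a *: n = 0.
exists D; split=> [M N f surj_f DM a Ia n|M].
  by have [m <-] := surj_f n; rewrite -linearZ DM ?linear0.
split=> [TM N f surj_f DN n|Mperp].
  have [m <-] := surj_f n; have [s Is ->] := (t_sigma _ _).1 (TM m).
  rewrite linear_sum big_seq big1 // => p sp; rewrite linearZ.
  by apply: DN; apply: (allP Is).
have [Q [q [surj_q q0]]] := quotient_exists (sigma M).
have DQ : D Q.
  move=> a Ia n; have [m <-] := surj_q n; rewrite -linearZ.
  apply/q0/t_sigma; exists [:: (a, m)]; last by rewrite big_seq1.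
  by rewrite /= andbT.
by move=> x; apply/q0; apply: (Mperp Q q).
Qed.

Theorem theorem4p23 (R : pzRingType) (hR : left_perfect R)
    (C : module_class R) :
  conatural C <->
  exists sigma : preradical R,
    t_radical sigma /\ (forall M : lmodType R, C M <-> torsion_class sigma M).
Proof.
split=> [[D [D_quot CE]]|[sigma [t_sigma CE]]]; last first.
  have [D [D_quot TE]] := torsion_class_conatural t_sigma.
  by exists D; split=> // M; rewrite CE.
pose E : module_class R := fun S => simple S /\ D S.
pose I : {pred R} := fun a => `[< annihilates E a >].
have I0 : 0 \in I by apply/asboolP; apply: annihilates0.
have ID : {in I &, forall a b, a + b \in I}.
  by move=> a b /asboolP Ia /asboolP Ib; apply/asboolP; apply: annihilatesD.
have IMl a : {in I, forall b, a * b \in I}.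
  by move=> b /asboolP Ib; apply/asboolP; apply: annihilates_mull.
have IMr b : {in I, forall a, a * b \in I}.
  by move=> a /asboolP Ia; apply/asboolP; apply: annihilates_mulr.
exists (ideal_radical IMl); split; first exact: ideal_radical_t.
move=> M; rewrite CE; split=> [Mperp x|TM N f surj_f DN].
  apply/ideal_radicalP.
  apply: in_ideal_mul_cover => // [S []|S [simS DS] g sg] //.
  by have [[y y0] _] := simS; apply: y0; apply: (Mperp S g).
apply: contrapT => /(nonzero_simple_quotient hR) [S [g [simS surj_g]]].
have ES : E S by split=> //; apply: D_quot surj_g DN.
have [[z z0] _] := simS; apply: z0.
have [y <-] := surj_g z; have [x <-] := surj_f y.
have /ideal_radicalP [s Is ->] := TM x.
rewrite !linear_sum big_seq big1 // => p sp; rewrite !linearZ.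
by have /asboolP := allP Is _ sp; apply.
Qed.
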